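(* If $\mathcal{I}$ is a P-ideal on $\omega$, then $$\mathfrak{b}\le\mathfrak{b}(\mathcal{I},\mathrm{Fin},\mathrm{Fin})=\mathfrak{b}(\mathcal{I},\mathcal{I},\mathcal{I})=\mathfrak{b}(\mathcal{I},\mathrm{Fin},\mathcal{I})=\mathfrak{b}(\mathcal{I},\mathcal{I},\mathrm{Fin})\le\mathfrak{d}.$$
   Context: An ideal on $\omega$ is a family $\mathcal{I}\subseteq\mathcal{P}(\omega)$ closed under finite unions and subsets, containing all finite sets, with $\omega\notin\mathcal{I}$; $\mathrm{Fin}$ is the ideal of finite sets. $\mathcal{I}$ is a P-ideal if for every countable $\mathcal{A}\subseteq\mathcal{I}$ there is $B$ with $\omega\setminus B\in\mathcal{I}$ and $A\cap B$ finite for all $A\in\mathcal{A}$. $\mathfrak{b}$ and $\mathfrak{d}$ are the bounding and dominating numbers. For an ideal $\mathcal{K}$, $\widehat{\mathcal{P}}_{\mathcal{K}}$ is the family of sequences $\langle A_n\rangle$ of pairwise disjoint members of $\mathcal{K}$, and $\mathcal{P}_{\mathcal{K}}$ those with union $\omega$. $\mathfrak{b}(\mathcal{I},\mathcal{J},\mathcal{K})=\min\{|\mathcal{E}|:\mathcal{E}\subseteq\widehat{\mathcal{P}}_{\mathcal{K}},\ \forall\langle A_n\rangle\in\mathcal{P}_{\mathcal{J}}\ \exists\langle E_n\rangle\in\mathcal{E}\ \bigcup_n(A_n\cap\bigcup_{i\le n}E_i)\notin\mathcal{I}\}$, with $\min\emptyset=\mathfrak{c}^+$. *)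

(* Defs.v *)
From mathcomp Require Import all_boot.
From mathcomp Require Import boolp classical_sets functions cardinality.

Set Implicit Arguments.
Unset Strict Implicit.
Unset Printing Implicit Defensive.

Local Open Scope classical_set_scope.
Local Open Scope card_scope.
Local Open Scope quotient_scope.

(* Cardinal numbers, as equinumerosity classes of subsets of P(P(omega)). This
   type has one element for every cardinal up to 2^c. All families below are
   sets of functions in omega^omega or P(omega)^omega, hence of cardinality at
   most c, and c^+ <= 2^c, so every cardinal involved is represented. *)
Definition card_equiv (X Y : set (set (set nat))) : bool := X #= Y.

Lemma card_equiv_refl : reflexive card_equiv.
Proof. by move=> X; apply: card_eqxx. Qed.

Lemma card_equiv_sym : symmetric card_equiv.
Proof. by move=> X Y; apply: card_eq_sym. Qed.

Lemma card_equiv_trans : transitive card_equiv.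
Proof. by move=> Y X Z; apply: card_eq_trans. Qed.

Canonical card_equiv_rel :=
  EquivRel card_equiv card_equiv_refl card_equiv_sym card_equiv_trans.

Definition cardinal := {eq_quot card_equiv_rel}.

Definition has_card T (X : set T) (k : cardinal) : Prop := repr k #= X.

Definition cardinal_le (k l : cardinal) : Prop := repr k #<= repr l.

Declare Scope cardinal_scope.
Delimit Scope cardinal_scope with cardinal.
Notation "k <= l" := (cardinal_le k l) : cardinal_scope.

Definition is_least (S : set cardinal) (k : cardinal) : Prop :=
  S k /\ forall l, S l -> (k <= l)%cardinal.

(* By [ex_least] below, the default value [d] is returned exactly when S is
   empty. *)
Definition cardinal_min (d : cardinal) (S : set cardinal) : cardinal :=
  xget d [set k | is_least S k].

Lemma has_card_unique T (X : set T) (k l : cardinal) :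
  has_card X k -> has_card X l -> k = l.
Proof.
rewrite /has_card => Xk; rewrite card_eq_sym => Xl.
rewrite -[k]reprK -[l]reprK; apply/eqmodP; exact: card_eq_trans Xk Xl.
Qed.

Lemma ex_has_card T (X : set T) (f : T -> set (set nat)) :
  injective f -> exists k, has_card X k.
Proof.
move=> injf; exists (\pi_cardinal (f @` X)); rewrite /has_card.
have E : card_equiv (repr (\pi_cardinal (f @` X))) (f @` X).
  by apply/(@eqmodP _ card_equiv_rel); rewrite reprK.
by apply: card_eq_trans E _; apply: inj_card_eq => x y _ _ /injf.
Qed.

Lemma ex_least (S : set cardinal) : S !=set0 -> exists k, is_least S k.
Proof.
move=> [k0 Sk0]; apply: contrapT => noleast.
pose P (Z : set (cardinal -> set (set nat))) :=
  (forall z k, Z z -> S k -> repr k (z k)) /\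
  (forall y z k, Z y -> Z z -> S k -> y k = z k -> y = z).
have [|Z [[Zin Zinj] Zmax]] := @Zorn_bigcup _ P.
  move=> F FP totF; split.
    by move=> z k [A FA Az] Sk; have [+ _] := FP _ FA; apply.
  move=> y z k [A FA Ay] [B FB Bz] Sk.
  by case: (totF _ _ FA FB) => AB; [have [_ +] := FP _ FB|have [_ +] := FP _ FA];
    apply => //; apply: AB.
have [k Sk surjk] : exists2 k, S k & repr k `<=` (fun z => z k) @` Z.
  apply: contrapT => nosurj.
  have new k : exists x, S k -> repr k x /\ ~ ((fun z => z k) @` Z) x.
    have [Sk|nSk] := pselect (S k); last by exists set0.
    apply: contrapT => nox; apply: nosurj; exists k => // x kx.
    by apply: contrapT => nZx; apply: nox; exists x.
  have [w Hw] := choice new.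
  have nZw : ~ Z w by move=> Zw; have [_] := Hw _ Sk0; apply; exists w.
  apply: (Zmax (Z `|` [set w])).
    split; first by left.
    by move=> sub; apply: nZw; apply: sub; right.
  split.
    by move=> z k [Zz|->] Sk; [exact: Zin|have [] := Hw _ Sk].
  move=> y z k [Zy|->] [Zz|->] Sk // e; first exact: Zinj e.
    by have [_ []] := Hw _ Sk; exists y.
  by have [_ []] := Hw _ Sk; exists z.
apply: noleast; exists k; split => // l Sl.
apply: (@card_le_trans _ _ _ Z).
  apply: card_le_trans (card_image_le (fun z => z k) Z).
  exact: subset_card_le.
apply: (@card_le_trans _ _ _ ((fun z : cardinal -> _ => z l) @` Z)).
  suff: (fun z : cardinal -> _ => z l) @` Z #= Z.
    by rewrite card_eq_le => /andP[].
  by apply: inj_card_eq => y z; rewrite !inE => Zy Zz e; apply: Zinj e.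
by apply: subset_card_le => _ [z Zz <-]; apply: Zin.
Qed.

(* c^+; the default value is irrelevant, see [succ_continuumP]. *)
Definition succ_continuum : cardinal :=
  cardinal_min (\pi_cardinal set0)
    [set k : cardinal | ~ (repr k #<= [set: set nat])].

Lemma succ_continuumP :
  is_least [set k : cardinal | ~ (repr k #<= [set: set nat])] succ_continuum.
Proof.
apply: xgetPex; apply: ex_least.
have [k hk] := ex_has_card [set: set (set nat)] (@inj_id _).
exists k => /= kle.
have : [set: set (set nat)] #<= [set: set nat].
  by rewrite -(card_le_eql hk).
move=> /pcard_injP[f injTf].
pose D := [set x : set nat | exists2 X, f X = x & ~ X x].
have injf : injective f by move=> X Y; apply: injTf; rewrite inE.
have [DfD|nDfD] := pselect (D (f D)); last by apply: (nDfD); exists D.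
by case: (DfD) => X /injf ->; apply.
Qed.

Definition eventually_le (f g : nat -> nat) : Prop :=
  finite_set [set n | (g n < f n)%N].

Definition bounding_number : cardinal :=
  cardinal_min succ_continuum [set k | exists F : set (nat -> nat),
    (forall g, exists2 f, F f & ~ eventually_le f g) /\ has_card F k].

Definition dominating_number : cardinal :=
  cardinal_min succ_continuum [set k | exists D : set (nat -> nat),
    (forall f, exists2 g, D g & eventually_le f g) /\ has_card D k].

Definition is_ideal (I : set (set nat)) : Prop :=
  [/\ forall A B, I A -> I B -> I (A `|` B),
      forall A B, A `<=` B -> I B -> I A,
      forall A, finite_set A -> I A
    & ~ I [set: nat]].

Definition Fin : set (set nat) := [set A | finite_set A].

Definition is_P_ideal (I : set (set nat)) : Prop :=
  is_ideal I /\
  forall AA : set (set nat), countable AA -> AA `<=` I ->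
    exists2 B, I (~` B) & forall A, AA A -> finite_set (A `&` B).

Definition disjoint_seqs (K : set (set nat)) : set (nat -> set nat) :=
  [set E | (forall n, K (E n)) /\ trivIset [set: nat] E].

Definition partition_seqs (J : set (set nat)) : set (nat -> set nat) :=
  [set A | disjoint_seqs J A /\ \bigcup_n A n = [set: nat]].

Definition ideal_b (I J K : set (set nat)) : cardinal :=
  cardinal_min succ_continuum [set k | exists EE : set (nat -> set nat),
    [/\ EE `<=` disjoint_seqs K,
        forall A, partition_seqs J A -> exists2 E, EE E &
          ~ I (\bigcup_n (A n `&` \bigcup_(i < n.+1) E i))
      & has_card EE k]].

(* Main.v *)
Require Import Defs.
From mathcomp Require Import all_boot.
From mathcomp Require Import boolp classical_sets functions cardinality.
From mathcomp Require Import sequences.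

(** All the cardinals involved are norms of relations, the least sizes of a
    family of responses meeting every challenge, so each inequality reduces to
    a Tukey connection: a map on challenges and a map on responses in opposite
    directions. Enlarging J or shrinking K can only increase b(I,J,K), so
    b(I,Fin,I) is the smallest and b(I,I,Fin) the largest of the four values.
    They coincide because a P-ideal provides, for every sequence in I, a set B
    with complement in I on which every term is finite: cutting both the E_n
    and the A_n down to such sets changes the union of the A_n with the E_i,
    i <= n, only by a member of I. The comparison with b and d then only
    concerns sequences of finite sets: these yield functions bounding their
    terms, and conversely a function g yields the sequence of the initial
    segments [0, g(n)) made disjoint. *)

Set Implicit Arguments.
Unset Strict Implicit.
Unset Printing Implicit Defensive.

Local Open Scope classical_set_scope.
Local Open Scope card_scope.

(** * Cardinals *)

Lemma cardinal_le_refl (k : cardinal) : (k <= k)%cardinal.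
Proof. exact: card_lexx. Qed.

Lemma cardinal_le_trans (k l m : cardinal) :
  (k <= l)%cardinal -> (l <= m)%cardinal -> (k <= m)%cardinal.
Proof. exact: card_le_trans. Qed.

Lemma cardinal_le_anti (k l : cardinal) :
  (k <= l)%cardinal -> (l <= k)%cardinal -> k = l.
Proof.
move=> kl lk; apply: (@has_card_unique _ (repr l)); last exact: card_eqxx.
by rewrite /has_card card_eq_le; apply/andP.
Qed.

Lemma cardinal_le_total (k l : cardinal) :
  (k <= l)%cardinal \/ (l <= k)%cardinal.
Proof.
have [|m [[->|->] least]] := @ex_least [set k; l]; first by exists k; left.
  by left; apply: least; right.
by right; apply: least; left.
Qed.

Lemma cardinal_le_succ_continuum (k : cardinal) :
  repr k #<= [set: set nat] -> (k <= succ_continuum)%cardinal.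
Proof.
move=> kc; have [//|sk] := cardinal_le_total k succ_continuum.
by have [/= + _] := succ_continuumP; case; exact: card_le_trans sk kc.
Qed.

Lemma cardinal_min_lbound (d : cardinal) (S : set cardinal) (k : cardinal) :
  S k -> (cardinal_min d S <= k)%cardinal.
Proof.
move=> Sk; have [_] : is_least S (cardinal_min d S); last exact.
by apply: xgetPex; apply: ex_least; exists k.
Qed.

Lemma cardinal_min_glb (d : cardinal) (S : set cardinal) (m : cardinal) :
  (m <= d)%cardinal -> (forall k, S k -> (m <= k)%cardinal) ->
  (m <= cardinal_min d S)%cardinal.
Proof. by move=> md mS; rewrite /cardinal_min; case: xgetP => // k _ [/mS]. Qed.

Lemma cardinal_min_le_default (d : cardinal) (S : set cardinal) :
  (forall k, S k -> (k <= d)%cardinal) -> (cardinal_min d S <= d)%cardinal.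
Proof.
move=> Sd; rewrite /cardinal_min; case: xgetP => [k _ [/Sd] //|_].
exact: cardinal_le_refl.
Qed.

Lemma set1_injective T : injective (@set1 T).
Proof. by move=> x y xy; have : [set x] x by []; rewrite xy. Qed.

Lemma has_card_image T U (phi : T -> U) (X : set T) (k : cardinal) :
  [set: U] #<= [set: set nat] -> has_card X k ->
  exists2 l, has_card (phi @` X) l & (l <= k)%cardinal.
Proof.
move=> /pcard_injP[e inje] Xk.
have [|l Xl] := @ex_has_card _ (phi @` X) (set1 \o e).
  by move=> u v uv; apply: inje (set1_injective uv); rewrite in_setT.
exists l => //; rewrite /cardinal_le (card_le_eql Xl) (card_le_eqr Xk).
exact: card_image_le.
Qed.

Lemma inj_card_leT T (U : pointedType) (f : T -> U) :
  injective f -> [set: T] #<= [set: U].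
Proof. by move=> injf; apply/pcard_injP; exists f => x y _ _ /injf. Qed.

Lemma card_le_setfun_continuum (T U : countType) :
  [set: T -> set U] #<= [set: set nat].
Proof.
pose graph (E : T -> set U) := [set p | E p.1 p.2].
apply: (@inj_card_leT _ _ (fun E => pickle @` graph E)) => E F EF.
apply/funext => t; apply/funext => u.
have inj_pickle := pcan_inj (@pickleK (T * U)%type).
rewrite -[E t u]/(graph E (t, u)) -[F t u]/(graph F (t, u)).
by rewrite -!(image_inj inj_pickle) EF.
Qed.

Lemma card_le_fun_continuum (T U : countType) :
  [set: T -> U] #<= [set: set nat].
Proof.
apply: card_le_trans (card_le_setfun_continuum T U).
apply: (@inj_card_leT _ _ (fun f t => [set f t])) => f g fg.
by apply/funext => t; apply: set1_injective; rewrite (congr1 (@^~ t) fg).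
Qed.

(** * Norms of relations *)

Definition relation_norm T U (X : set T) (Y : set U) (R : T -> U -> Prop) :
    cardinal :=
  cardinal_min succ_continuum [set k | exists F : set U,
    [/\ F `<=` Y, forall x, X x -> exists2 y, F y & R x y & has_card F k]].

Lemma relation_normT T U (R : T -> U -> Prop) :
  relation_norm setT setT R = cardinal_min succ_continuum
    [set k | exists F : set U,
      (forall x, exists2 y, F y & R x y) /\ has_card F k].
Proof.
congr cardinal_min; apply/seteqP; split=> k [F].
  by move=> [_ RF Fk]; exists F; split=> // x; exact: RF.
by move=> [RF Fk]; exists F; split.
Qed.

Lemma tukey_relation_norm_le T U T' U'
    (X : set T) (Y : set U) (R : T -> U -> Prop)
    (X' : set T') (Y' : set U') (R' : T' -> U' -> Prop)
    (psi : T -> T') (phi : U' -> U) :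
  [set: U] #<= [set: set nat] ->
  set_fun X X' psi -> set_fun Y' Y phi ->
  (forall x y', X x -> Y' y' -> R' (psi x) y' -> R x (phi y')) ->
  (relation_norm X Y R <= relation_norm X' Y' R')%cardinal.
Proof.
move=> Uc psiX phiY RR'; apply: cardinal_min_glb => [|k [F [FY' RF Fk]]].
  apply: cardinal_min_le_default => k [F [_ _ Fk]].
  apply: cardinal_le_succ_continuum; rewrite (card_le_eql Fk).
  exact: card_le_trans (card_leT F) Uc.
have [l phiFl lk] := has_card_image phi Uc Fk.
apply: cardinal_le_trans lk; apply: cardinal_min_lbound.
exists (phi @` F); split=> // [_ [y' Fy' <-]|x Xx]; first exact/phiY/FY'.
have [y' Fy' Ry'] := RF _ (psiX _ Xx).
by exists (phi y'); [exists y'|apply: RR' => //; exact: FY'].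
Qed.

Lemma bounding_numberE :
  bounding_number = relation_norm setT setT (fun g f => ~ eventually_le f g).
Proof. by rewrite relation_normT. Qed.

Lemma dominating_numberE :
  dominating_number = relation_norm setT setT eventually_le.
Proof. by rewrite relation_normT. Qed.

Definition diagonal_trace (A E : nat -> set nat) : set nat :=
  \bigcup_n (A n `&` \bigcup_(i < n.+1) E i).

Lemma ideal_bE (I J K : set (set nat)) :
  ideal_b I J K = relation_norm (partition_seqs J) (disjoint_seqs K)
    (fun A E => ~ I (diagonal_trace A E)).
Proof. by []. Qed.

Lemma disjoint_seqs_sub (K K' : set (set nat)) :
  K `<=` K' -> disjoint_seqs K `<=` disjoint_seqs K'.
Proof. by move=> KK' E [KE tE]; split=> // n; exact: KK'. Qed.

Lemma partition_seqs_sub (J J' : set (set nat)) :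
  J `<=` J' -> partition_seqs J `<=` partition_seqs J'.
Proof. by move=> JJ' A [DA cA]; split=> //; exact: disjoint_seqs_sub DA. Qed.

Lemma ideal_b_mono (I J K J' K' : set (set nat)) :
  J `<=` J' -> K' `<=` K ->
  (ideal_b I J K <= ideal_b I J' K')%cardinal.
Proof.
move=> JJ' K'K; rewrite !ideal_bE.
apply: (tukey_relation_norm_le (psi := id) (phi := id)) => //.
- exact: card_le_setfun_continuum.
- exact: partition_seqs_sub.
- exact: disjoint_seqs_sub.
Qed.

(** * Reduction to sequences of finite sets *)

Definition almost_disjoint_set (I : set (set nat)) (E : nat -> set nat) :
    set nat :=
  xget set0 [set B | I (~` B) /\ forall n, finite_set (E n `&` B)].

Lemma almost_disjoint_setP (I : set (set nat)) (E : nat -> set nat) :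
  is_P_ideal I -> (forall n, I (E n)) ->
  I (~` almost_disjoint_set I E) /\
  forall n, finite_set (E n `&` almost_disjoint_set I E).
Proof.
move=> [_ PII] IE.
apply: (xgetPex set0 (P := [set B | I (~` B) /\ _])).
have [||B IB finB] := PII (range E); first exact: card_image_le.
  by move=> _ [n _ <-].
by exists B; split=> // n; apply: finB; exists n.
Qed.

Definition cut (B : set nat) (E : nat -> set nat) : nat -> set nat :=
  fun n => E n `&` B.

(* The points outside B are put back one at a time to preserve the union. *)
Definition cut_partition (B : set nat) (A : nat -> set nat) : nat -> set nat :=
  fun n => (A n `&` B) `|` ([set n] `\` B).

Lemma cut_disjoint_seqs (B : set nat) (K K' : set (set nat))
    (E : nat -> set nat) :
  disjoint_seqs K E -> (forall n, K' (E n `&` B)) ->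
  disjoint_seqs K' (cut B E).
Proof. by move=> [_ tE] K'E; split=> //; exact: trivIset_setIr. Qed.

Lemma cut_partition_seqs (B : set nat) (J : set (set nat))
    (A : nat -> set nat) :
  partition_seqs J A -> (forall n, finite_set (A n `&` B)) ->
  partition_seqs Fin (cut_partition B A).
Proof.
move=> [[_ tA] cA] finA; split; first split=> [n|].
- by rewrite /Fin /= finite_setU; split; [exact: finA|exact: finite_setD].
- move=> i j _ _ [x [[[Aix Bx]|[/= -> nB]] [[Ajx Bx']|[/= xj nB']]]] //.
  by apply: tA => //; exists x.
- apply/seteqP; split=> // x _.
  have [Bx|nBx] := pselect (B x); last by exists x => //; right.
  by have [n _ Anx] : (\bigcup_n A n) x by [rewrite cA]; exists n => //; left.
Qed.

Lemma diagonal_trace_cut_partition (A E : nat -> set nat) (B C : set nat) :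
  diagonal_trace (cut_partition B A) E `<=`
  diagonal_trace A (cut C E) `|` (~` B `|` ~` C).
Proof.
move=> x [n _ [[[Anx Bx]|[_ nBx]] [i ilen Eix]]]; last by right; left.
have [Cx|nCx] := pselect (C x); last by right; right.
by left; exists n => //; split=> //; exists i.
Qed.

Lemma P_ideal_ideal_b_le (I : set (set nat)) : is_P_ideal I ->
  (ideal_b I I Fin <= ideal_b I Fin I)%cardinal.
Proof.
move=> PI; have [[IU Isub _ _] _] := PI; rewrite !ideal_bE.
pose ads := almost_disjoint_set I; have adsP := almost_disjoint_setP PI.
apply: (tukey_relation_norm_le
  (psi := fun A => cut_partition (ads A) A) (phi := fun E => cut (ads E) E)).
- exact: card_le_setfun_continuum.
- move=> A PA; have [[/adsP[_ finA] _] _] := PA.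
  exact: cut_partition_seqs PA _.
- move=> E DE; have [/adsP[_ finE] _] := DE.
  exact: cut_disjoint_seqs DE _.
- move=> A E [[/adsP[IA _] _] _] [/adsP[IE _] _]; apply: contra_not => Icut.
  apply: Isub (@diagonal_trace_cut_partition A E (ads A) (ads E)) _.
  exact: IU _ _ Icut (IU _ _ IA IE).
Qed.

Lemma P_ideal_ideal_b_eq (I J K : set (set nat)) : is_P_ideal I ->
  Fin `<=` J -> J `<=` I -> Fin `<=` K -> K `<=` I ->
  ideal_b I J K = ideal_b I Fin I.
Proof.
move=> PI FJ JI FK KI; apply: cardinal_le_anti; last exact: ideal_b_mono.
by apply: cardinal_le_trans (P_ideal_ideal_b_le PI); exact: ideal_b_mono.
Qed.

(** * Comparison with the bounding and dominating numbers *)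

Definition strict_bound (A : set nat) : nat := xget 0 [set m | A `<=` `I_m].

Lemma strict_boundP (A : set nat) : finite_set A -> A `<=` `I_(strict_bound A).
Proof.
move=> /finite_seqP[s ->]; apply: (xgetPex 0 (P := [set m | _ `<=` `I_m])).
exists (\max_(x <- s) x).+1 => x /= xs.
by rewrite ltnS; exact: (leq_bigmax_seq (F := id)).
Qed.

Definition cumulative_bound (E : nat -> set nat) (n : nat) : nat :=
  strict_bound (\bigcup_(i < n.+1) E i).

Lemma cumulative_boundP (E : nat -> set nat) (n : nat) :
  (forall i, finite_set (E i)) ->
  \bigcup_(i < n.+1) E i `<=` `I_(cumulative_bound E n).
Proof.
move=> finE; apply: strict_boundP.
by apply: bigcup_finite => [|i _]; [exact: finite_II|exact: finE].
Qed.

Definition layers (g : nat -> nat) : nat -> set nat :=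
  seqDU (fun n => `I_(g n)).

Lemma layers_disjoint_seqs (g : nat -> nat) : disjoint_seqs Fin (layers g).
Proof.
split=> [n|]; last exact: trivIset_seqDU.
by apply: finite_setD; exact: finite_II.
Qed.

Lemma layers_partition_seqs (g : nat -> nat) :
  (forall x, exists n, (x < g n)%N) -> partition_seqs Fin (layers g).
Proof.
move=> unbounded; split; first exact: layers_disjoint_seqs.
rewrite -seqDU_bigcup_eq; apply/seteqP; split=> // x _.
by have [n xn] := unbounded x; exists n.
Qed.

Lemma layers_ge (g : nat -> nat) (i n : nat) :
  (i < n)%N -> layers g n `<=` [set x | (g i <= x)%N].
Proof.
rewrite /layers /seqDU -(bigcup_mkord n (fun k => `I_(g k))).
move=> iltn x [_ nx] /=; rewrite leqNgt; apply/negP => xi.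
by apply: nx; exists i.
Qed.

Lemma sub_bigcup_layers (g : nat -> nat) (n : nat) :
  `I_(g n) `<=` \bigcup_(i < n.+1) layers g i.
Proof.
rewrite bigcup_mkord -bigsetU_seqDU -(bigcup_mkord n.+1 (fun k => `I_(g k))).
by move=> x xn; exists n => /=.
Qed.

Lemma eventually_le_finite_bigcup (f g : nat -> nat) (A : nat -> set nat) :
  eventually_le f g -> (forall n, finite_set (A n)) ->
  finite_set (\bigcup_(n in [set n | (g n < f n)%N]) A n).
Proof. by move=> fg finA; exact: bigcup_finite. Qed.

(* The shift makes the layers cover omega and puts every layer but the first
   above the value of g at its index. *)
Definition upper_layers (g : nat -> nat) : nat -> set nat :=
  layers (fun n => g n.+1 + n.+1)%N.

Lemma upper_layers_partition_seqs (g : nat -> nat) :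
  partition_seqs Fin (upper_layers g).
Proof. by apply: layers_partition_seqs => x; exists x; exact: leq_addl. Qed.

Lemma upper_layers_ge (g : nat -> nat) (n : nat) :
  (0 < n)%N -> upper_layers g n `<=` [set x | (g n <= x)%N].
Proof.
case: n => // n _ x /(layers_ge (ltnSn n)) /=.
exact/leq_trans/leq_addr.
Qed.

Lemma bounding_number_le_ideal_b (I : set (set nat)) : Fin `<=` I ->
  (bounding_number <= ideal_b I Fin Fin)%cardinal.
Proof.
move=> FI; rewrite bounding_numberE ideal_bE.
apply: (tukey_relation_norm_le
  (psi := upper_layers) (phi := cumulative_bound)) => //.
- exact: card_le_fun_continuum.
- by move=> g _; exact: upper_layers_partition_seqs.
- move=> g E _ [finE _]; apply: contra_not => Eg; apply: FI.
  have [[finA _] _] := upper_layers_partition_seqs g.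
  have finAEg := eventually_le_finite_bigcup Eg finA.
  apply: sub_finite_set (_ : finite_set (upper_layers g 0 `|` _)); last first.
    by rewrite finite_setU; split; [exact: finA|exact: finAEg].
  move=> x [n _ [Anx Enx]]; have [n0|n0] := posnP n; first by left; rewrite -n0.
  right; exists n => //=.
  exact: leq_ltn_trans (upper_layers_ge n0 Anx) (cumulative_boundP finE Enx).
Qed.

Lemma ideal_b_le_dominating_number (I : set (set nat)) : is_ideal I ->
  (ideal_b I Fin Fin <= dominating_number)%cardinal.
Proof.
move=> [IU Isub FI nIT]; rewrite dominating_numberE ideal_bE.
apply: (tukey_relation_norm_le
  (psi := fun A => strict_bound \o A) (phi := layers)) => //.
- exact: card_le_setfun_continuum.
- by move=> g _; exact: layers_disjoint_seqs.
- move=> A g [[finA _] cA] _ Ag IA; apply: nIT.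
  have IAg := FI _ (eventually_le_finite_bigcup Ag finA).
  apply: Isub (IU _ _ IA IAg) => x _.
  have [n _ Anx] : (\bigcup_n A n) x by rewrite cA.
  have xlt := strict_boundP (finA n) Anx.
  have [gA|Ag'] := ltnP (g n) (strict_bound (A n)); first by right; exists n.
  left; exists n; split=> //; apply: sub_bigcup_layers.
  exact: leq_trans xlt Ag'.
Qed.

Theorem theorem4p5 (I : set (set nat)) (PI : is_P_ideal I) :
  [/\ (bounding_number <= ideal_b I Fin Fin)%cardinal,
      ideal_b I Fin Fin = ideal_b I I I,
      ideal_b I I I = ideal_b I Fin I,
      ideal_b I Fin I = ideal_b I I Fin
    & (ideal_b I I Fin <= dominating_number)%cardinal].
Proof.
have idealI : is_ideal I by case: PI.
have FI : Fin `<=` I by case: idealI.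
have ideal_b_eq J K := @P_ideal_ideal_b_eq I J K PI.
split.
- exact: bounding_number_le_ideal_b.
- by rewrite !ideal_b_eq.
- exact: ideal_b_eq.
- by rewrite [RHS]ideal_b_eq.
- rewrite ideal_b_eq // -(ideal_b_eq Fin Fin) //.
  exact: ideal_b_le_dominating_number.
Qed.
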